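(* Let $0<a\le A$ and $\gamma>0$, let $\mathbb{R}^n_+=\{x\in\mathbb{R}^n: x_n>0\}$, and consider the problem $$(P_\gamma)\qquad \mathcal{M}_{a,A}^+(D^2u)-\gamma u=0\ \text{ in }\mathbb{R}^n_+,\qquad -\frac{\partial u}{\partial x_n}=u\ \text{ on }\partial\mathbb{R}^n_+ .$$ If $\gamma>A$, then any bounded viscosity subsolution of $(P_\gamma)$ is non-positive in $\mathbb{R}^n_+$. If $\gamma>a$, then any bounded viscosity supersolution of $(P_\gamma)$ is non-negative in $\mathbb{R}^n_+$. Hence, if $\gamma>A$, there are no non-trivial bounded viscosity solutions of $(P_\gamma)$.
   Context: $S(n)$ is the space of real symmetric $n\times n$ matrices with the usual ordering. For $M\in S(n)$, $\mathcal{M}_{a,A}^+(M)=\sup\{\mathrm{tr}(\sigma M): \sigma\in S(n),\ aI\le\sigma\le AI\}$. Viscosity solutions of $(P_\gamma)$. A function $u\in USC(\overline{\mathbb{R}^n_+})$ (upper semicontinuous on the closed half-space) is a viscosity subsolution if whenever $\varphi\in C^2(\overline{\mathbb{R}^n_+})$ and $u-\varphi$ has a local maximum (relative to $\overline{\mathbb{R}^n_+}$) at $x_0$: (i) if $x_0\in\mathbb{R}^n_+$, then $\mathcal{M}_{a,A}^+(D^2\varphi(x_0))-\gamma u(x_0)\ge0$; (ii) if $x_0\in\partial\mathbb{R}^n_+$, then $\min\{-(\mathcal{M}_{a,A}^+(D^2\varphi(x_0))-\gamma u(x_0)),\ -\frac{\partial\varphi}{\partial x_n}(x_0)-u(x_0)\}\le0$.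 A function $u\in LSC(\overline{\mathbb{R}^n_+})$ (lower semicontinuous) is a viscosity supersolution if whenever $\varphi\in C^2(\overline{\mathbb{R}^n_+})$ and $u-\varphi$ has a local minimum at $x_0$: (i) if $x_0\in\mathbb{R}^n_+$, then $\mathcal{M}_{a,A}^+(D^2\varphi(x_0))-\gamma u(x_0)\le0$; (ii) if $x_0\in\partial\mathbb{R}^n_+$, then $\max\{-(\mathcal{M}_{a,A}^+(D^2\varphi(x_0))-\gamma u(x_0)),\ -\frac{\partial\varphi}{\partial x_n}(x_0)-u(x_0)\}\ge0$. A viscosity solution is a continuous function on $\overline{\mathbb{R}^n_+}$ that is both a subsolution and a supersolution. *)

(* Defs.v *)
From HB Require Import structures.
From mathcomp Require Import all_boot all_order all_algebra.
From mathcomp Require Import all_classical all_reals all_analysis.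

Set Implicit Arguments.
Unset Strict Implicit.
Unset Printing Implicit Defensive.

Import Order.TTheory GRing.Theory Num.Theory.
Import numFieldNormedType.Exports.

Local Open Scope classical_set_scope.
Local Open Scope ring_scope.

(* Euclidean space of dimension n + 1 >= 1 is 'rV[R]_n.+1, and the
   distinguished coordinate x_n is the last one, x 0 ord_max. *)

Definition halfspace (R : realType) (n : nat) : set 'rV[R]_n.+1 :=
  [set x | 0 < x 0 ord_max].

Definition closed_halfspace (R : realType) (n : nat) : set 'rV[R]_n.+1 :=
  [set x | 0 <= x 0 ord_max].

Definition halfspace_boundary (R : realType) (n : nat) : set 'rV[R]_n.+1 :=
  [set x | x 0 ord_max = 0].

Arguments halfspace {R n}.
Arguments closed_halfspace {R n}.
Arguments halfspace_boundary {R n}.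

Definition loewner_le (R : realType) (m : nat) (M N : 'M[R]_m) : Prop :=
  forall v : 'rV[R]_m, (v *m M *m v^T) 0 0 <= (v *m N *m v^T) 0 0.

(* For 0 < a <= A the set below is nonempty and bounded, so [sup] is its
   actual least upper bound. *)
Definition pucci_sup (R : realType) (m : nat) (a A : R) (M : 'M[R]_m) : R :=
  sup [set \tr (sigma *m M) | sigma in
        [set sigma : 'M[R]_m | [/\ sigma^T = sigma,
           loewner_le a%:M sigma & loewner_le sigma A%:M]]].

Definition partial (R : realType) (n : nat) (i : 'I_n.+1)
    (f : 'rV[R]_n.+1 -> R) : 'rV[R]_n.+1 -> R :=
  'D_(delta_mx 0 i) f.

Definition hessian (R : realType) (n : nat) (f : 'rV[R]_n.+1 -> R)
    (x : 'rV[R]_n.+1) : 'M[R]_n.+1 :=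
  \matrix_(i, j) partial j (partial i f) x.

Definition C2_on (R : realType) (n : nat) (U : set 'rV[R]_n.+1)
    (f : 'rV[R]_n.+1 -> R) : Prop :=
  forall x, U x ->
    {for x, continuous f} /\
    forall i, [/\ derivable f x (delta_mx 0 i),
      {for x, continuous (partial i f)} &
      forall j, derivable (partial i f) x (delta_mx 0 j) /\
        {for x, continuous (partial j (partial i f))}].

(* C^2 on a set that need not be open: twice continuously differentiable in
   some open neighbourhood of it.  On the closed half-space the values of f on
   the half-space alone determine its derivatives up to order 2, including at
   boundary points. *)
Definition C2 (R : realType) (n : nat) (D : set 'rV[R]_n.+1)
    (f : 'rV[R]_n.+1 -> R) : Prop :=
  exists U : set 'rV[R]_n.+1, [/\ open U, D `<=` U & C2_on U f].

(* Semicontinuity on D is taken for the topology induced on D; the values of u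
   outside D are irrelevant. *)
Definition LSC (R : realType) (n : nat) (D : set 'rV[R]_n.+1)
    (u : 'rV[R]_n.+1 -> R) : Prop :=
  lower_semicontinuous (fun x : subspace D => (u x)%:E).

Definition USC (R : realType) (n : nat) (D : set 'rV[R]_n.+1)
    (u : 'rV[R]_n.+1 -> R) : Prop :=
  LSC D (fun x => - u x).

Definition local_max_on (R : realType) (n : nat) (D : set 'rV[R]_n.+1)
    (f : 'rV[R]_n.+1 -> R) (x0 : 'rV[R]_n.+1) : Prop :=
  D x0 /\ \forall x \near within D (nbhs x0), f x <= f x0.

Definition local_min_on (R : realType) (n : nat) (D : set 'rV[R]_n.+1)
    (f : 'rV[R]_n.+1 -> R) (x0 : 'rV[R]_n.+1) : Prop :=
  D x0 /\ \forall x \near within D (nbhs x0), f x0 <= f x.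

Definition viscosity_subsolution (R : realType) (n : nat) (a A gamma : R)
    (u : 'rV[R]_n.+1 -> R) : Prop :=
  USC closed_halfspace u /\
  forall (phi : 'rV[R]_n.+1 -> R) (x0 : 'rV[R]_n.+1),
    C2 closed_halfspace phi ->
    local_max_on closed_halfspace (fun x => u x - phi x) x0 ->
    (halfspace x0 ->
       0 <= pucci_sup a A (hessian phi x0) - gamma * u x0) /\
    (halfspace_boundary x0 ->
       Num.min (- (pucci_sup a A (hessian phi x0) - gamma * u x0))
               (- partial ord_max phi x0 - u x0) <= 0).

Definition viscosity_supersolution (R : realType) (n : nat) (a A gamma : R)
    (u : 'rV[R]_n.+1 -> R) : Prop :=
  LSC closed_halfspace u /\
  forall (phi : 'rV[R]_n.+1 -> R) (x0 : 'rV[R]_n.+1),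
    C2 closed_halfspace phi ->
    local_min_on closed_halfspace (fun x => u x - phi x) x0 ->
    (halfspace x0 ->
       pucci_sup a A (hessian phi x0) - gamma * u x0 <= 0) /\
    (halfspace_boundary x0 ->
       0 <= Num.max (- (pucci_sup a A (hessian phi x0) - gamma * u x0))
                    (- partial ord_max phi x0 - u x0)).

Definition viscosity_solution (R : realType) (n : nat) (a A gamma : R)
    (u : 'rV[R]_n.+1 -> R) : Prop :=
  [/\ {within closed_halfspace, continuous u},
      viscosity_subsolution a A gamma u &
      viscosity_supersolution a A gamma u].

(* Main.v *)
(* With v = u for subsolutions and v = -u for supersolutions, suppose that
   v > 0 somewhere and let b = A, resp. b = a.  For k = sqrt (gamma / b) > 1 and
   0 < c < k - 1, the profile f = exp (- k x_n) + c is bounded above and away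
   from 0, satisfies b f'' < gamma f, and -f' > f on the boundary.  With
   theta = sup (v / f), the penalised function v - theta f - eta |x|^2 attains
   its maximum, where v is as close as desired to theta f when eta is small.
   The barrier theta f + eta |x|^2 (or its opposite, which touches u from
   below) is then a test function violating both alternatives.  The Hessian of
   the barrier is diagonal and nonnegative, so the Pucci operator is A times its
   trace, and a times the trace for the opposite barrier: hence the two
   different thresholds for gamma. *)
Require Import Defs.
From mathcomp Require Import all_boot all_order all_algebra.
From mathcomp Require Import all_classical all_reals all_analysis.
From mathcomp Require Import ring lra.
Import Order.TTheory GRing.Theory Num.Theory.
Import numFieldNormedType.Exports.
Local Open Scope classical_set_scope.
Local Open Scope ring_scope.

(** * Minima of semicontinuous functions on compact sets *)

(** The sublevel sets of [g] in [K] at the values [g w] are nested and nonempty, so they generate a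
    proper filter. A cluster point [p] is a minimiser: if [g w < g p], semicontinuity gives a
    neighbourhood of [p] that misses the sublevel set of [w]. *)
Lemma lsc_compact_min (T : topologicalType) (R : realType) (K : set T)
    (g : T -> R) :
  compact K -> K !=set0 ->
  (forall x c, K x -> c < g x -> \forall z \near within K (nbhs x), c < g z) ->
  exists2 x, K x & forall z, K z -> g x <= g z.
Proof.
move=> cK [x0 Kx0] lscg.
pose F := filter_from K (fun w => [set z | K z /\ g z <= g w]).
have FF : Filter F.
  apply: filter_from_filter; first by exists x0.
  move=> v w Kv Kw; have [vw|wv] := leP (g v) (g w).
    exists v => // z [Kz zv]; split; split => //; exact: le_trans vw.
  exists w => // z [Kz zw]; split; split => //; exact: le_trans (ltW wv).
have PF : ProperFilter F.
  by apply: filter_from_proper => w Kw; exists w.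
have FK : F K by exists x0 => // z [].
have [p [Kp clp]] := cK F PF FK.
exists p => // w Kw; rewrite leNgt; apply/negP => wp.
have FW : F [set z | K z /\ g z <= g w] by exists w.
have [z [[Kz zw] /(_ Kz)]] := clp _ _ FW (lscg p (g w) Kp wp).
by rewrite ltNge zw.
Qed.

(** * Calculus of sums of functions of one coordinate *)

(** The difference quotient along a basis vector is either that of [f] or identically zero. *)
Lemma is_derive_coord (R : realType) (n : nat) (f : R -> R) (df : R)
    (x : 'rV[R]_n.+1) (i j : 'I_n.+1) :
  is_derive (x 0 j) 1 f df ->
  is_derive x (delta_mx 0 i) (fun y : 'rV[R]_n.+1 => f (y 0 j))
    ((i == j)%:R * df).
Proof.
move=> [dvf <-].
have E : (fun h : R => h^-1 *: (((fun y : 'rV[R]_n.+1 => f (y 0 j)) \o shift x)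
    (h *: delta_mx 0 i) - f (x 0 j))) =
  if i == j then (fun h : R => h^-1 *: ((f \o shift (x 0 j)) (h *: 1) - f (x 0 j)))
  else (fun=> 0).
  apply/funext => h /=; rewrite !mxE eqxx /= (eq_sym j).
  case: eqP => [_|_] //=.
  by rewrite mulr0 add0r subrr scaler0.
split.
  by rewrite /derivable E; case: eqP => _; [exact: dvf|exact: is_cvg_cst].
rewrite /derive E; case: eqP => _; first by rewrite mul1r.
by rewrite mul0r; exact: lim_cst.
Qed.

Lemma partial_coord (R : realType) (n : nat) (f df : R -> R) (i j : 'I_n.+1) :
  (forall t : R, is_derive t 1 f (df t)) ->
  partial i (fun x => f (x 0 j)) = fun x => (i == j)%:R * df (x 0 j).
Proof.
move=> hf; apply/funext => x; rewrite /partial.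
by case: (is_derive_coord _ _ f _ x i j (hf _)).
Qed.

Lemma continuous_coord (R : realType) (n : nat) (f : R -> R) (j : 'I_n.+1) :
  continuous f -> continuous (fun y : 'rV[R]_n.+1 => f (y 0 j)).
Proof.
move=> cf x; apply: (@continuous_comp _ _ _ (fun y : 'rV[R]_n.+1 => y 0 j) f).
  exact: coord_continuous.
exact: cf.
Qed.

Lemma is_derive_continuous (R : realType) (f df : R -> R) :
  (forall t : R, is_derive t 1 f (df t)) -> continuous f.
Proof.
move=> hf t; apply: differentiable_continuous.
by apply/derivable1_diffP; case: (hf t).
Qed.

(** The barrier has this form, which reduces its derivatives to one-variable ones and makes its
    Hessian diagonal. *)
Definition sepsum (R : realType) (n : nat) (g : 'I_n.+1 -> R -> R)
    (x : 'rV[R]_n.+1) : R := \sum_j g j (x 0 j).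

Arguments sepsum {R n}.

Lemma sepsumE (R : realType) (n : nat) (g : 'I_n.+1 -> R -> R) :
  sepsum g = \sum_j (fun y : 'rV[R]_n.+1 => g j (y 0 j)).
Proof. by apply/funext => y; rewrite /sepsum fct_sumE. Qed.

Lemma is_derive_sepsum (R : realType) (n : nat) (g dg : 'I_n.+1 -> R -> R)
    (x : 'rV[R]_n.+1) (i : 'I_n.+1) :
  (forall j (t : R), is_derive t 1 (g j) (dg j t)) ->
  is_derive x (delta_mx 0 i) (sepsum g) (dg i (x 0 i)).
Proof.
move=> hg; rewrite sepsumE.
have hs j := is_derive_coord _ _ _ _ x i j (hg j _).
apply: (is_derive_eq (is_derive_sum hs)).
rewrite (bigD1 i) //= eqxx mul1r big1 ?addr0 // => j ji.
by rewrite eq_sym (negbTE ji) mul0r.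
Qed.

Lemma partial_sepsum (R : realType) (n : nat) (g dg : 'I_n.+1 -> R -> R)
    (i : 'I_n.+1) :
  (forall j (t : R), is_derive t 1 (g j) (dg j t)) ->
  partial i (sepsum g) = fun x => dg i (x 0 i).
Proof.
by move=> hg; apply/funext => x; case: (is_derive_sepsum _ _ g dg x i hg).
Qed.

Lemma continuous_sepsum (R : realType) (n : nat) (g : 'I_n.+1 -> R -> R) :
  (forall j, continuous (g j)) -> continuous (sepsum g).
Proof.
move=> cg; rewrite sepsumE; elim/big_ind : _ => [x|p q cp cq x|j _].
- exact: cst_continuous.
- exact: continuousD (cp x) (cq x).
- exact: continuous_coord (cg j).
Qed.

Lemma C2_sepsum (R : realType) (n : nat) (g dg ddg : 'I_n.+1 -> R -> R) D :
  (forall j (t : R), is_derive t 1 (g j) (dg j t)) ->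
  (forall j (t : R), is_derive t 1 (dg j) (ddg j t)) ->
  (forall j, continuous (ddg j)) ->
  C2 D (sepsum g).
Proof.
move=> hg hdg cddg; exists setT; split=> //; first exact: openT.
move=> x _; split.
  exact: continuous_sepsum (fun j => is_derive_continuous _ _ _ (hg j)) x.
move=> i; rewrite (partial_sepsum _ _ g dg i hg); split.
- by case: (is_derive_sepsum _ _ g dg x i hg).
- exact: continuous_coord (is_derive_continuous _ _ _ (hdg i)) x.
- move=> j; rewrite (partial_coord _ _ _ (ddg i) j i (hdg i)); split.
    by case: (is_derive_coord _ _ _ _ x j i (hdg i _)).
  apply: continuousM; first exact: cst_continuous.
  exact: (continuous_coord _ _ _ i (cddg i)) x.
Qed.

Lemma hessian_sepsum (R : realType) (n : nat) (g dg ddg : 'I_n.+1 -> R -> R)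
    (x : 'rV[R]_n.+1) :
  (forall j (t : R), is_derive t 1 (g j) (dg j t)) ->
  (forall j (t : R), is_derive t 1 (dg j) (ddg j t)) ->
  hessian (sepsum g) x = diag_mx (\row_i ddg i (x 0 i)).
Proof.
move=> hg hdg; apply/matrixP => i j.
rewrite /hessian !mxE (partial_sepsum _ _ g dg i hg).
rewrite (partial_coord _ _ _ (ddg i) j i (hdg i)) eq_sym.
by case: eqP => [->|_]; rewrite ?mul1r ?mul0r.
Qed.

(** * The Pucci operator on diagonal matrices of constant sign *)

(** The lower bound comes from the admissible matrix [c%:M]. For the upper bound, testing the
    Loewner inequalities on basis vectors bounds the diagonal of [sigma], and this is all that a
    diagonal [M] sees. *)
Lemma pucci_sup_bounds (R : realType) (m : nat) (a A c b : R) (M : 'M[R]_m) :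
  a <= c <= A ->
  (forall sigma : 'M[R]_m, (forall i, a <= sigma i i <= A) ->
     \tr (sigma *m M) <= b) ->
  c * \tr M <= pucci_sup a A M <= b.
Proof.
move=> /andP[ac cA] hb; rewrite /pucci_sup; set S := [set _ | _ in _].
have Sc : S (c * \tr M).
  have quad (t : R) (v : 'rV[R]_m) :
      (v *m t%:M *m v^T) 0 0 = t * (v *m v^T) 0 0.
    by rewrite mul_mx_scalar -scalemxAl mxE.
  have sq (v : 'rV[R]_m) : 0 <= (v *m v^T) 0 0.
    by rewrite mxE sumr_ge0 // => i _; rewrite mxE -expr2 sqr_ge0.
  exists c%:M; last by rewrite mul_scalar_mx mxtraceZ.
  by split; rewrite ?tr_scalar_mx // => v; rewrite !quad ler_wpM2r.
have ubS : ubound S b.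
  move=> _ [s [_ as_ sA] <-]; apply: hb => i.
  pose e : 'rV[R]_m := delta_mx 0 i.
  have eE (N : 'M[R]_m) : (e *m N *m e^T) 0 0 = N i i.
    by rewrite trmx_delta -colE mxE -rowE mxE.
  move: (as_ e) (sA e).
  by rewrite !eE !mxE eqxx !mulr1n => -> ->.
apply/andP; split; first by apply: ub_le_sup => //; exists b.
by apply: ge_sup => //; exists (c * \tr M).
Qed.

(** The trace is the sum of the [sigma i i * d 0 i], which is largest at [sigma = A%:M]; for
    nonpositive entries the extremal matrix is [a%:M]. *)
Lemma pucci_sup_diag_ge0 (R : realType) (m : nat) (a A : R) (d : 'rV[R]_m) :
  a <= A -> (forall i, 0 <= d 0 i) ->
  pucci_sup a A (diag_mx d) = A * \sum_i d 0 i.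
Proof.
move=> aA d0; apply/eqP; rewrite eq_le andbC -{1}mxtrace_diag.
apply: pucci_sup_bounds; first by rewrite aA lexx.
move=> s sb; rewrite mulr_sumr ler_sum // => i _.
by rewrite mul_mx_diag mxE ler_wpM2r //; case/andP: (sb i).
Qed.

Lemma pucci_sup_diag_le0 (R : realType) (m : nat) (a A : R) (d : 'rV[R]_m) :
  a <= A -> (forall i, d 0 i <= 0) ->
  pucci_sup a A (diag_mx d) = a * \sum_i d 0 i.
Proof.
move=> aA d0; apply/eqP; rewrite eq_le andbC -{1}mxtrace_diag.
apply: pucci_sup_bounds; first by rewrite aA lexx.
move=> s sb; rewrite mulr_sumr ler_sum // => i _.
by rewrite mul_mx_diag mxE ler_wnM2r //; case/andP: (sb i).
Qed.

(** * The barrier and its derivatives *)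

(** The boolean factor puts the exponential profile on the last coordinate only, while every
    coordinate carries its share of the quadratic penalty. One formula for all [j] lets
    differentiation proceed without a case split. *)
Definition barrier (R : realType) (n : nat) (k c theta eta : R) (j : 'I_n.+1)
    (t : R) : R :=
  (j == ord_max)%:R * (theta * (expR (- k * t) + c)) + eta * t ^+ 2.

Definition dbarrier (R : realType) (n : nat) (k theta eta : R) (j : 'I_n.+1)
    (t : R) : R :=
  (j == ord_max)%:R * (- theta * k * expR (- k * t)) + 2 * eta * t.

Definition ddbarrier (R : realType) (n : nat) (k theta eta : R) (j : 'I_n.+1)
    (t : R) : R :=
  (j == ord_max)%:R * (theta * k ^+ 2 * expR (- k * t)) + 2 * eta.

Arguments barrier {R n}.
Arguments dbarrier {R n}.
Arguments ddbarrier {R n}.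

Lemma is_derive_expRM (R : realType) (k t : R) :
  is_derive t 1 (fun s : R => expR (k * s)) (k * expR (k * t)).
Proof.
have h : is_derive t 1 (fun s : R => k * s) k.
  by apply: is_derive_eq; rewrite /GRing.scale /= mulr1.
by apply: (is_derive_eq (@is_derive1_comp _ expR _ _ _ _ (is_derive_expR (k * t)) h));
  rewrite mulrC.
Qed.

Lemma is_derive_barrier (R : realType) (n : nat) (k c theta eta : R)
    (j : 'I_n.+1) (t : R) :
  is_derive t 1 (barrier k c theta eta j) (dbarrier k theta eta j t).
Proof.
have he := is_derive_expRM R (- k) t.
rewrite /barrier; apply: is_derive_eq.
rewrite /dbarrier /GRing.scale /=; ring.
Qed.

Lemma is_derive_dbarrier (R : realType) (n : nat) (k theta eta : R)
    (j : 'I_n.+1) (t : R) :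
  is_derive t 1 (dbarrier k theta eta j) (ddbarrier k theta eta j t).
Proof.
have he := is_derive_expRM R (- k) t.
rewrite /dbarrier; apply: is_derive_eq.
rewrite /ddbarrier /GRing.scale /=; ring.
Qed.

(** Continuity follows from exhibiting the third derivative. *)
Lemma continuous_ddbarrier (R : realType) (n : nat) (k theta eta : R)
    (j : 'I_n.+1) : continuous (ddbarrier k theta eta j).
Proof.
apply: (@is_derive_continuous _ _ (fun t => (j == ord_max)%:R *
  (theta * k ^+ 2 * (- k * expR (- k * t))))) => t.
have he := is_derive_expRM R (- k) t.
rewrite /ddbarrier; apply: is_derive_eq.
by rewrite /GRing.scale /= addr0.
Qed.

Lemma barrierE (R : realType) (n : nat) (k c theta eta : R)
    (x : 'rV[R]_n.+1) :
  sepsum (barrier k c theta eta) x =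
  theta * (expR (- k * x 0 ord_max) + c) + eta * \sum_j x 0 j ^+ 2.
Proof.
rewrite /sepsum big_split /= mulr_sumr; congr (_ + _).
rewrite (bigD1 ord_max) //= eqxx mul1r big1 ?addr0 // => j /negbTE ->.
by rewrite mul0r.
Qed.

Lemma sum_ddbarrier (R : realType) (n : nat) (k theta eta : R)
    (x : 'rV[R]_n.+1) :
  \sum_j ddbarrier k theta eta j (x 0 j) =
  theta * k ^+ 2 * expR (- k * x 0 ord_max) + 2 * eta * n.+1%:R.
Proof.
rewrite /ddbarrier big_split /= sumr_const card_ord mulr_natr; congr (_ + _).
rewrite (bigD1 ord_max) //= eqxx mul1r big1 ?addr0 // => j /negbTE ->.
by rewrite mul0r.
Qed.

Lemma ddbarrier_ge0 (R : realType) (n : nat) (k theta eta : R)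
    (j : 'I_n.+1) (t : R) :
  0 <= theta -> 0 <= eta -> 0 <= ddbarrier k theta eta j t.
Proof.
move=> th0 et0; rewrite /ddbarrier addr_ge0 //; last by rewrite mulr_ge0.
by rewrite mulr_ge0 // mulr_ge0 ?expR_ge0 // mulr_ge0 // sqr_ge0.
Qed.

(** * Maxima over the closed half-space and the touching point *)

Lemma compact_closed_halfspace_box (R : realType) (n : nat) (r : R) :
  compact (closed_halfspace `&` [set x : 'rV[R]_n.+1 | forall j, `|x 0 j| <= r]).
Proof.
rewrite setIC; apply: compact_closedI.
  have := @rV_compact R n.+1 (fun=> [set` `[- r, r]]) (fun=> @segment_compact R (- r) r).
  congr (compact _); apply/seteqP; split => x /= h j; have := h j;
    by rewrite /= in_itv /= ler_norml.
have -> : closed_halfspace = (fun x : 'rV[R]_n.+1 => x 0 ord_max) @^-1` [set t | 0 <= t].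
  by [].
apply: closed_comp => [x _|]; [exact: coord_continuous|exact: closed_ge].
Qed.

(** All points at least as good as [y] lie in a compact box, so a maximum over the box is global. *)
Lemma usc_halfspace_max (R : realType) (n : nat) (v phi : 'rV[R]_n.+1 -> R)
    (y : 'rV[R]_n.+1) (r : R) :
  USC closed_halfspace v -> continuous phi -> closed_halfspace y ->
  (forall x, closed_halfspace x -> v y - phi y <= v x - phi x ->
     forall j, `|x 0 j| <= r) ->
  exists2 x, closed_halfspace x &
    forall z, closed_halfspace z -> v z - phi z <= v x - phi x.
Proof.
move=> uv cphi Dy hr.
set K := closed_halfspace `&` [set x : 'rV[R]_n.+1 | forall j, `|x 0 j| <= r].
have Ky : K y by split => //; exact: hr.
have [||x c [Dx _] cx|x [Dx _] hx] :=
  @lsc_compact_min _ R K (fun x => phi x - v x).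
- exact: compact_closed_halfspace_box.
- by exists y.
(* The gap above [c] is split evenly between the semicontinuity of [v] and the continuity of
   [phi]. *)
- pose e := (phi x - v x - c) / 2.
  have e0 : 0 < e by rewrite divr_gt0 // subr_gt0.
  have vxe : ((- v x - e)%:E < (- v x)%:E)%E by rewrite lte_fin ltrBlDr ltrDl.
  have [V + hV] := uv x (- v x - e) vxe.
  rewrite -[nbhs _](nbhs_subspace_in Dx) => Vx.
  have Px : \forall z \near x, phi x - e < phi z.
    by apply: (cvgr_gt (phi x) (cphi x)); rewrite ltrBlDr ltrDl.
  have Vx' : nbhs x (fun z => closed_halfspace z -> V z) by exact: Vx.
  apply: filterS (filterI Vx' Px) => z [Vz pz] [Dz _].
  by move: (hV z (Vz Dz)) pz; rewrite lte_fin /e; lra.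
- exists x => // z Dz; have [yz|zy] := leP (v y - phi y) (v z - phi z).
    have := hx z (conj Dz (hr z Dz yz)); lra.
  have := hx y Ky; lra.
Qed.

(** Only [v] and [k] appear, so that the lemma applies to [u] and to [- u]. Multiplied by [b], where
    [b * k ^+ 2 = gamma], the bound on the second derivatives violates the equation; the last
    conclusion violates the boundary condition. *)
Lemma touching_barrier (R : realType) (n : nat) (k M : R)
    (v : 'rV[R]_n.+1 -> R) (x1 : 'rV[R]_n.+1) :
  1 < k -> (forall x, closed_halfspace x -> v x <= M) ->
  USC closed_halfspace v ->
  closed_halfspace x1 -> 0 < v x1 ->
  exists c theta eta x,
    [/\ 0 <= theta, 0 <= eta,
      local_max_on closed_halfspace
        (fun z => v z - sepsum (barrier k c theta eta) z) x,
      \sum_j ddbarrier k theta eta j (x 0 j) < k ^+ 2 * v x &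
      halfspace_boundary x -> v x < - dbarrier k theta eta (@ord_max n) (x 0 ord_max)].
Proof.
move=> k1 hM uv Dx1 vx1.
(* Any [c] strictly between 0 and [k - 1] would do: at the boundary the profile equals [1 + c] and
   its slope is [- k]. *)
pose c := (k - 1) / 2.
have c0 : 0 < c by rewrite /c; lra.
have ck : 1 + c < k by rewrite /c; lra.
pose f (x : 'rV[R]_n.+1) := expR (- k * x 0 ord_max) + c.
have fc x : c < f x by rewrite /f ltrDr expR_gt0.
have f0 x : 0 < f x by rewrite (lt_trans c0).
have f1 x : closed_halfspace x -> f x <= 1 + c.
  move=> Dx; rewrite lerD2r -expR0 ler_expR mulNr oppr_le0 mulr_ge0 //; lra.
pose S := [set v x / f x | x in closed_halfspace].
have M0 : 0 <= M by rewrite (le_trans (ltW vx1)) ?hM.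
have supS : has_sup S.
  split; first by exists (v x1 / f x1); exists x1.
  exists (M / c) => _ [x Dx <-]; rewrite ler_pdivrMr //.
  rewrite (le_trans (hM x Dx)) // -mulrA ler_peMr //.
  by rewrite mulrC ler_pdivlMr // mul1r ltW.
pose theta := sup S.
have vf x : closed_halfspace x -> v x <= theta * f x.
  move=> Dx; rewrite -ler_pdivrMr //; apply: ub_le_sup; last by exists x.
  by case: supS.
have t0 : 0 < theta.
  by have := vf _ Dx1; rewrite -(pmulr_lgt0 _ (f0 x1)); apply: lt_le_trans.
have tc0 : 0 < theta * c by rewrite mulr_gt0.
(* The accuracy [d] for the supremum of [v / f] is divided by [1 + c], because multiplying back by
   [f y <= 1 + c] must cost at most [theta * c / 4]. *)
have [y Dy hy] : exists2 y, closed_halfspace y & theta * f y - theta * c / 4 < v y.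
  pose d := theta * c / 4 / (1 + c).
  have d0 : 0 < d by rewrite !divr_gt0 //; lra.
  have [_ [y Dy <-] hy] := sup_adherent d0 supS.
  exists y => //; move: hy; rewrite ltr_pdivlMr // => hy.
  apply: le_lt_trans hy; rewrite mulrBl lerB //.
  rewrite (le_trans (ler_wpM2l (ltW d0) (f1 y Dy))) // /d.
  by rewrite divfK // gt_eqF //; lra.
pose N (x : 'rV[R]_n.+1) : R := \sum_j x 0 j ^+ 2.
have N0 x : 0 <= N x by rewrite sumr_ge0 // => j _; rewrite sqr_ge0.
have n0 : 0 <= n.+1%:R :> R by [].
(* [B] dominates both [N y] and [2 * n.+1%:R], so this [eta] keeps the penalty at [y] and its
   Laplacian below [theta * c / 4]. *)
pose B := 1 + N y + 2 * n.+1%:R.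
have B0 : 0 < B by rewrite /B; have := N0 y; lra.
pose eta := theta * c / 4 / B.
have eta0 : 0 < eta by rewrite !divr_gt0.
have etaB : eta * B = theta * c / 4 by rewrite divfK // gt_eqF.
have etaN : eta * N y <= theta * c / 4.
  by rewrite -etaB ler_pM2l // /B; lra.
have etan : 2 * eta * n.+1%:R <= theta * c / 4.
  have := N0 y; rewrite -etaB /B; nra.
have bE x : sepsum (barrier k c theta eta) x = theta * f x + eta * N x.
  exact: barrierE.
have [||//|x Dx hx|x Dx hx] := @usc_halfspace_max R n v
  (sepsum (barrier k c theta eta)) y (1 + theta * c / eta).
- exact: uv.
- by apply: continuous_sepsum => j;
    exact: is_derive_continuous (is_derive_barrier _ _ k c theta eta j).
- move: hx; rewrite !bE => hx j.
  have Nx : eta * N x <= theta * c by have := vf x Dx; lra.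
  have xN : `|x 0 j| ^+ 2 <= theta * c / eta.
    rewrite ler_pdivlMr // mulrC (le_trans _ Nx) // ler_pM2l //.
    rewrite real_normK ?num_real // /N (bigD1 j) //= lerDl sumr_ge0 // => i _.
    by rewrite sqr_ge0.
  (* From [t ^+ 2 <= s] follows [t <= 1 + s], hence the box radius [1 + theta * c / eta] with no
     square root. *)
  have := normr_ge0 (x 0 j); nra.
(* Comparison with [y] loses [theta * c / 4] through [hy] and as much again through the penalty at
   [y]. *)
have vx : theta * f x - theta * c / 2 <= v x.
  have := hx y Dy; rewrite !bE.
  have : 0 <= eta * N x by rewrite mulr_ge0 // ltW.
  lra.
exists c, theta, eta, x; split; [exact: ltW|exact: ltW| | |].
- by split => //; rewrite near_withinE; apply: nearW.
- rewrite sum_ddbarrier.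
  have k2 : 1 < k ^+ 2 by rewrite exprn_egt1 //; lra.
  (* The constant [c] in the profile has no second derivative, so a surplus [k ^+ 2 * theta * c / 2]
     remains and absorbs [2 * eta * n.+1%:R]. *)
  apply: lt_le_trans (ler_wpM2l _ vx); last by rewrite sqr_ge0.
  rewrite /f; set e := expR _; nra.
- move=> x0; have x0E : x 0 ord_max = 0 by [].
  rewrite /dbarrier eqxx mul1r x0E !mulr0 expR0.
  (* The penalty has zero normal derivative at the boundary, which leaves
     [v x <= theta * (1 + c) < theta * k]. *)
  have := ler_wpM2l (ltW t0) (f1 x Dx).
  have : theta * (1 + c) < theta * k by rewrite ltr_pM2l.
  have := vf x Dx; lra.
Qed.

(** * Signs of bounded subsolutions and supersolutions *)

Lemma scaling_factor (R : realType) (b gamma : R) : 0 < b -> b < gamma ->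
  exists2 k, 1 < k & b * k ^+ 2 = gamma.
Proof.
move=> b0 bg; exists (Num.sqrt (gamma / b)).
  rewrite -[ltLHS]sqrtr1 ltr_sqrt; last by rewrite divr_gt0 // (lt_trans b0).
  by rewrite ltr_pdivlMr // mul1r.
rewrite sqr_sqrtr; last by rewrite divr_ge0 // ltW // (lt_trans b0).
by rewrite mulrC divfK // gt_eqF.
Qed.

(** The bound includes the boundary, as is needed to conclude that solutions vanish on the closed
    half-space. *)
Lemma viscosity_subsolution_le0 (R : realType) (n : nat) (a A gamma : R)
    (u : 'rV[R]_n.+1 -> R) :
  0 < A -> a <= A -> A < gamma ->
  [bounded u x | x in closed_halfspace] ->
  viscosity_subsolution a A gamma u ->
  forall x, closed_halfspace x -> u x <= 0.
Proof.
move=> A0 aA Ag bu [uu hu] x1 Dx1; rewrite leNgt; apply/negP => ux1.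
have [k k1 kE] := scaling_factor _ _ _ A0 Ag.
have /pinfty_ex_gt0[M _ bM] := bu.
have hM x : closed_halfspace x -> u x <= M.
  by move=> /bM; apply: le_trans; rewrite ler_norm.
have [c [th [et [x [th0 et0 hmax hin hbd]]]]] :=
  touching_barrier _ _ _ _ _ _ k1 hM uu Dx1 ux1.
have hb := is_derive_barrier R n k c th et.
have hdb := is_derive_dbarrier R n k th et.
have hC2 := C2_sepsum R n _ _ _ closed_halfspace hb hdb
  (continuous_ddbarrier R n k th et).
have [hi hbo] := hu _ _ hC2 hmax.
have pucci : pucci_sup a A (hessian (sepsum (barrier k c th et)) x) < gamma * u x.
  rewrite (hessian_sepsum _ _ _ _ _ x hb hdb) pucci_sup_diag_ge0 //.
    rewrite -kE -mulrA ltr_pM2l //.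
    by under eq_bigr do rewrite mxE.
  by move=> i; rewrite mxE ddbarrier_ge0.
case: hmax => Dx _; have [x0|x0] := eqVneq (x 0 ord_max) 0.
  (* Both arguments of the minimum are positive, by [pucci] and [hbd]. *)
  move: (hbo x0); rewrite (partial_sepsum _ _ _ _ ord_max hb) ge_min.
  by have := hbd x0; move=> + /orP[]; lra.
have : halfspace x by rewrite /halfspace /= lt_neqAle eq_sym x0.
by move=> /hi; lra.
Qed.

Lemma viscosity_supersolution_ge0 (R : realType) (n : nat) (a A gamma : R)
    (u : 'rV[R]_n.+1 -> R) :
  0 < a -> a <= A -> a < gamma ->
  [bounded u x | x in closed_halfspace] ->
  viscosity_supersolution a A gamma u ->
  forall x, closed_halfspace x -> 0 <= u x.
Proof.
move=> a0 aA ag bu [lu hu] x1 Dx1; rewrite leNgt; apply/negP => ux1.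
have [k k1 kE] := scaling_factor _ _ _ a0 ag.
have /pinfty_ex_gt0[M _ bM] := bu.
have hM x : closed_halfspace x -> - u x <= M.
  by move=> /bM; apply: le_trans; rewrite -normrN ler_norm.
have uv : USC closed_halfspace (fun x => - u x).
  by rewrite /USC; under eq_fun do rewrite opprK.
have vx1 : 0 < - u x1 by rewrite oppr_gt0.
have [c [th [et [x [th0 et0 hmax hin hbd]]]]] :=
  touching_barrier _ _ _ _ _ _ k1 hM uv Dx1 vx1.
(* The barrier is linear in [theta] and [eta], so its opposite is again a barrier, with both
   parameters negated. *)
have hb := is_derive_barrier R n k c (- th) (- et).
have hdb := is_derive_dbarrier R n k (- th) (- et).
have hC2 := C2_sepsum R n _ _ _ closed_halfspace hb hdb
  (continuous_ddbarrier R n k (- th) (- et)).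
pose phi := sepsum (barrier k c (- th) (- et)) : 'rV[R]_n.+1 -> R.
have phiE z : phi z = - sepsum (barrier k c th et) z.
  by rewrite /phi !barrierE; ring.
have dE j t : dbarrier k (- th) (- et) j t = - dbarrier k th et j t :> R.
  by rewrite /dbarrier; ring.
have ddE j t : ddbarrier k (- th) (- et) j t = - ddbarrier k th et j t :> R.
  by rewrite /ddbarrier; ring.
have hmin : local_min_on closed_halfspace (fun z => u z - phi z) x.
  case: hmax => Dx hx; split => //; apply: filterS hx => z.
  by rewrite !phiE; lra.
have [hi hbo] := hu _ _ hC2 hmin.
have pucci : gamma * u x < pucci_sup a A (hessian phi x).
  rewrite (hessian_sepsum _ _ _ _ _ x hb hdb) pucci_sup_diag_le0 //.
    rewrite -kE -mulrA ltr_pM2l //.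
    under eq_bigr do rewrite mxE ddE.
    by rewrite sumrN; lra.
  by move=> i; rewrite mxE ddE oppr_le0 ddbarrier_ge0.
case: hmax => Dx _; have [x0|x0] := eqVneq (x 0 ord_max) 0.
  (* Here both arguments of the maximum are negative. *)
  move: (hbo x0); rewrite (partial_sepsum _ _ _ _ ord_max hb) le_max dE.
  by have := hbd x0; move=> + /orP[]; lra.
have : halfspace x by rewrite /halfspace /= lt_neqAle eq_sym x0.
by move=> /hi; lra.
Qed.

Theorem theorem5p1 (R : realType) (n : nat) (a A gamma : R)
    (ha : 0 < a) (haA : a <= A) (hgamma : 0 < gamma) :
  [/\ A < gamma ->
        forall u : 'rV[R]_n.+1 -> R,
          [bounded u x | x in closed_halfspace] ->
          viscosity_subsolution a A gamma u ->
          forall x, halfspace x -> u x <= 0,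
      a < gamma ->
        forall u : 'rV[R]_n.+1 -> R,
          [bounded u x | x in closed_halfspace] ->
          viscosity_supersolution a A gamma u ->
          forall x, halfspace x -> 0 <= u x
    & A < gamma ->
        forall u : 'rV[R]_n.+1 -> R,
          [bounded u x | x in closed_halfspace] ->
          viscosity_solution a A gamma u ->
          forall x, closed_halfspace x -> u x = 0].
Proof.
have A0 : 0 < A := lt_le_trans ha haA.
split=> [Ag u bu su x /ltW Dx|ag u bu su x /ltW Dx|Ag u bu [_ su Su] x Dx].
- exact: (viscosity_subsolution_le0 _ _ a A gamma u).
- exact: (viscosity_supersolution_ge0 _ _ a A gamma u).
apply/eqP; rewrite eq_le; apply/andP; split.
  exact: (viscosity_subsolution_le0 _ _ a A gamma u).
apply: (viscosity_supersolution_ge0 _ _ a A gamma u) => //.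
exact: le_lt_trans Ag.
Qed.
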